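(* Let $K$ be an integral polytopal complex of dimension $d$ (in particular, $K$ may be a lattice polytope). Then every entry of the $f^*$-vector $f^*(L_K,d)=(f^*_0,\ldots,f^*_d)$ is a non-negative integer.
   Context: A polytopal complex is a finite set $K$ of polytopes such that every face of a member of $K$ is in $K$ and the intersection of two members is a face of both; it is integral if all vertices of its members lie in $\mathbb{Z}^n$, and its dimension is the maximal dimension of its members. Its Ehrhart function is $L_K(k)=\#(\mathbb{Z}^n\cap k|K|)$ for integers $k\geq1$, where $|K|$ is the union of all members; it agrees with a polynomial of degree at most $d$, also denoted $L_K$. For a polynomial $p$ of degree at most $d$, $f^*(p,d)=(f^*_0,\ldots,f^*_d)$ is the unique vector with $p(k)=\sum_{i=0}^d f^*_i\binom{k-1}{i}$, where $\binom{x}{i}=x(x-1)\cdots(x-i+1)/i!$. *)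

(* Defs.v *)
From HB Require Import structures.
From mathcomp Require Import all_boot all_order all_algebra finmap.
From mathcomp Require Import boolp classical_sets functions cardinality reals.

Set Implicit Arguments.
Unset Strict Implicit.
Unset Printing Implicit Defensive.

Import Order.TTheory GRing.Theory Num.Theory.

Local Open Scope classical_set_scope.
Local Open Scope ring_scope.

Section Polytopes.
Variables (R : realType) (n : nat).
Implicit Types (A P F : set 'rV[R]_n) (K : set (set 'rV[R]_n)).
Implicit Types (s : seq 'rV[R]_n) (v x : 'rV[R]_n).

Definition conv_hull s : set 'rV[R]_n :=
  [set x | exists w : 'I_(size s) -> R,
     [/\ forall i, 0 <= w i, \sum_i w i = 1 & x = \sum_i w i *: s`_i]].

Definition affine_hull A : set 'rV[R]_n :=
  [set x | exists (m : nat) (a : 'I_m -> 'rV[R]_n) (w : 'I_m -> R),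
     [/\ forall i, A (a i), \sum_i w i = 1 & x = \sum_i w i *: a i]].

Definition dotv (a x : 'rV[R]_n) : R := \sum_i a 0 i * x 0 i.

(* The empty set is a polytope ([s = [::]]). *)
Definition polytope P := exists s, P = conv_hull s.

(* Faces are cut out by valid inequalities [dotv a x <= b]; [a = 0] with
   [b = 0], resp. [b = 1], makes [P] itself, resp. the empty set, a face. *)
Definition face P F := exists (a : 'rV[R]_n) (b : R),
  (forall x, P x -> dotv a x <= b) /\ F = P `&` [set x | dotv a x = b].

Definition vertex P v := face P [set v].

(* No [e : nat] satisfies [set_dim set0 e]: the empty set has dimension -1. *)
Definition set_dim P (e : nat) := exists (x : 'rV[R]_n) (U : {vspace 'rV[R]_n}),
  affine_hull P = [set x + u | u in [set u | u \in U]] /\ \dim U = e.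

Definition polytopal_complex K :=
  [/\ finite_set K,
      forall P, K P -> polytope P,
      forall P F, K P -> face P F -> K F &
      forall P Q, K P -> K Q -> face P (P `&` Q) /\ face Q (P `&` Q)].

Definition lattice : set 'rV[R]_n := [set x | forall i, x 0 i \is a Num.int].

Definition integral_complex K := forall P v, K P -> vertex P v -> lattice v.

Definition complex_dim K (d : nat) :=
  (exists2 P, K P & set_dim P d) /\
  (forall P e, K P -> set_dim P e -> (e <= d)%N).

Definition complex_support K : set 'rV[R]_n := \bigcup_(P in K) P.

Definition ehrhart K (k : nat) : nat :=
  #|` fset_set (lattice `&` [set k%:R *: x | x in complex_support K]) |.

Definition ehrhart_poly K (d : nat) (p : {poly R}) :=
  (size p <= d.+1)%N /\
  forall k : nat, (0 < k)%N -> p.[k%:R] = (ehrhart K k)%:R.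

(* [fset_set] is [fset0] on infinite sets; this never happens here. *)
Lemma finite_lattice_dilate K (k : nat) : polytopal_complex K ->
  finite_set (lattice `&` [set k%:R *: x | x in complex_support K]).
Proof.
move=> [finK polK _ _].
rewrite /complex_support image_bigcup setI_bigcupr; apply: bigcup_finite => // P KP.
have [s ->] := polK _ KP.
pose M := k%:R * \sum_(i < size s) \sum_(j < n) `|s`_i 0 j|.
pose N := (Num.truncn M).+1.
have ltMN : M < N%:R by apply: truncnS_gt.
pose g (u : {ffun 'I_n -> 'I_(N + N).+1}) : 'rV[R]_n :=
  \row_j ((u j)%:R - N%:R).
apply: (@sub_finite_set _ _ (range g)); last exact: finite_image.
move=> y [Ly [x [w [w0 w1 xE]] yE]]; subst y.
have bnd j : `|(k%:R *: x) 0 j| <= M.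
  rewrite mxE normrM normr_nat ler_wpM2l ?ler0n // xE summxE.
  apply: (le_trans (ler_norm_sum _ _ _)); apply: ler_sum => i _.
  rewrite mxE normrM ger0_norm //.
  apply: (@le_trans _ _ `|s`_i 0 j|).
    rewrite ler_piMl // -w1 (bigD1 i) //= lerDl.
    exact: sumr_ge0.
  rewrite (bigD1 j) //= lerDl; exact: sumr_ge0.
have ex j : exists u : 'I_(N + N).+1, (k%:R *: x) 0 j = u%:R - N%:R.
  have /intrP[z zE] := Ly j.
  have := le_lt_trans (bnd j) ltMN; rewrite zE ltr_norml => /andP[lo hi].
  have z0 : (0 <= z + N%:Z)%R.
    by rewrite -(@ler0z R) rmorphD /= -lerBlDr sub0r ltW.
  have zu : (`|(z + N%:Z)%R|%N < (N + N).+1)%N.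
    rewrite ltnS -lez_nat gez0_abs // -(@ler_int R) rmorphD /= PoszD rmorphD /=.
    by rewrite lerD2r ltW.
  exists (Ordinal zu) => /=.
  by rewrite -[X in X - _]/((Posz _)%:~R) gez0_abs // rmorphD /= addrK.
have [u uE] := choice ex.
exists (finfun u) => //; apply/rowP => j.
by rewrite !mxE ffunE -uE mxE.
Qed.

End Polytopes.

Section FStar.
Variable R : realType.
Implicit Types (p : {poly R}) (x : R).

Definition gbinom x (i : nat) : R := (\prod_(j < i) (x - j%:R)) / (i`!)%:R.

Definition is_fstar p d (f : 'rV[R]_d.+1) :=
  forall x, p.[x] = \sum_(i < d.+1) f 0 i * gbinom (x - 1) i.

Definition fstar p d : 'rV[R]_d.+1 := xget 0 [set f | is_fstar p f].

Local Definition bpoly (i : nat) : {poly R} := \prod_(j < i) ('X - (1 + j%:R)%:P).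

Local Lemma bpolyE i x : (bpoly i).[x] = gbinom (x - 1) i * (i`!)%:R.
Proof.
rewrite /gbinom divfK ?pnatr_eq0 -?lt0n ?fact_gt0// horner_prod.
by apply: eq_bigr => j _; rewrite hornerXsubC opprD addrA.
Qed.

Local Lemma size_bpoly i : size (bpoly i) = i.+1.
Proof. by rewrite /bpoly size_prod_XsubC -[index_enum _]enumT size_enum_ord. Qed.

Local Lemma bpoly_monic i : bpoly i \is monic.
Proof. exact: monic_prod_XsubC. Qed.

Lemma fstar_ex p d : (size p <= d.+1)%N -> exists f : 'rV[R]_d.+1, is_fstar p f.
Proof.
suff H : forall m p, (size p <= m)%N -> exists f : nat -> R,
    forall x, p.[x] = \sum_(i < m) f i * gbinom (x - 1) i.
  move=> /H[f fE]; exists (\row_i f i) => x.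
  by rewrite fE; apply: eq_bigr => i _; rewrite mxE.
move=> {p d}; elim=> [|m IHm] p sp.
  move: sp; rewrite leqn0 size_poly_eq0 => /eqP ->.
  by exists (fun=> 0) => x; rewrite horner0 big_ord0.
have [|f fE] := IHm (p - p`_m *: bpoly m).
  apply/leq_sizeP => j; rewrite leq_eqVlt coefB coefZ => /predU1P[<-|mj].
    have := bpoly_monic m; rewrite monicE lead_coefE size_bpoly => /eqP ->.
    by rewrite mulr1 subrr.
  have -> : p`_j = 0 by apply: nth_default; exact: leq_trans mj.
  have -> : (bpoly m)`_j = 0 by apply: nth_default; rewrite size_bpoly.
  by rewrite mulr0 subrr.
exists (fun i => if i == m then p`_m * (m`!)%:R else f i) => x.
rewrite big_ord_recr /= eqxx.
under eq_bigr => i _ do rewrite (ltn_eqF (ltn_ord i)).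
rewrite -fE hornerD hornerN hornerZ bpolyE.
set a := p`_m; set b := gbinom _ _; set c := _%:R; rewrite -[a * c * b]mulrA.
by rewrite (mulrC c b) subrK.
Qed.

Local Lemma gbinom_nat (m i : nat) : gbinom m%:R i = 'C(m, i)%:R.
Proof.
have fne : (i`!)%:R != 0 :> R by rewrite pnatr_eq0 -lt0n fact_gt0.
apply: (mulIf fne); rewrite /gbinom divfK // -natrM bin_ffact.
elim: i {fne} => [|i IHi]; first by rewrite big_ord0.
rewrite big_ord_recr /= IHi ffactnSr natrM.
have [im|mi] := leqP i m; first by rewrite natrB.
by rewrite ffact_small // !mul0r.
Qed.

Lemma fstar_inj p d (f g : 'rV[R]_d.+1) : is_fstar p f -> is_fstar p g -> f = g.
Proof.
move=> fE gE; apply/rowP => i.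
suff H m : forall i : 'I_d.+1, (i < m)%N -> f 0 i = g 0 i by exact: (H i.+1).
elim: m => // m IHm {}i; rewrite ltnS leq_eqVlt => /predU1P[im|/IHm//].
have := fE (1 + i%:R); rewrite gE addrAC subrr add0r => E.
apply/esym; move: E; rewrite (bigD1 i) //= [X in _ = X](bigD1 i) //=.
rewrite gbinom_nat binn !mulr1.
rewrite [X in _ = _ + X](eq_bigr (fun j : 'I_d.+1 => g 0 j * gbinom i%:R j)).
  by move=> /addIr.
move=> j ji; rewrite gbinom_nat; have [jm|] := ltnP j m; first by rewrite IHm.
rewrite -im leq_eqVlt eq_sym => /predU1P[/val_inj jE|lt]; last first.
  by rewrite bin_small // !mulr0.
by rewrite jE eqxx in ji.
Qed.

Lemma fstarP p d : (size p <= d.+1)%N -> is_fstar p (fstar p d).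
Proof. by move=> /fstar_ex; exact: xgetPex. Qed.

End FStar.

Lemma ehrhart_poly_inj (R : realType) n (K : set (set 'rV[R]_n)) d p q :
  ehrhart_poly K d p -> ehrhart_poly K d q -> p = q.
Proof.
move=> [sp pE] [sq qE]; apply/eqP; rewrite -subr_eq0.
apply/eqP/(@roots_geq_poly_eq0 _ _ [seq k.+1%:R | k <- iota 0 d.+1]).
- by apply/allP => _ /mapP[k _ ->]; rewrite rootE hornerD hornerN pE // qE // subrr.
- rewrite map_inj_uniq ?iota_uniq // => i j /eqP.
  by rewrite eqr_nat => /eqP[].
- rewrite size_map size_iota (leq_trans (size_polyD _ _)) //.
  by rewrite size_polyN geq_max sp sq.
Qed.

(* Main.v *)
(** Order the lattice points of |K|, and give every point of the cone over |K| its
    lexicographically least weight vector among the nonnegative weights on the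
    lattice points of one cell. Being least depends only on the support of the
    weights, is inherited by subsets of the support, and forces the support to be
    affinely independent: the supports of least weights form a triangulation of
    |K| without new vertices. That every point has such weights needs each
    polytope to be the hull of its vertices, which follows from Farkas' lemma.

    Subtracting integers from the least weights of a lattice point at height k
    until all nonzero ones lie in (0, 1] leaves a box point u, with support of
    size e + 1 and integral height h <= e + 1, plus a composition of k - h into
    e + 1 parts. Hence L_K(k) is the sum over u of
      C(k - h + e, e) = sum_j C(e + 1 - h, e - j) C(k - 1, j)
    by Vandermonde, and the f*-coefficients are sums of binomial coefficients. *)
Require Import Defs.
From mathcomp Require Import all_boot all_order all_algebra finmap.
From mathcomp Require Import boolp classical_sets functions cardinality reals.
From mathcomp Require Import ring lra zify.

Set Implicit Arguments.
Unset Strict Implicit.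
Unset Printing Implicit Defensive.

Import Order.TTheory GRing.Theory Num.Theory.

Local Open Scope ring_scope.

(** * Lexicographic order and supports of weight vectors *)

Section Weights.
Variables (R : realType) (N : nat).
Implicit Types u v w : 'rV[R]_N.

(** [u] precedes [w] lexicographically when [lexneg (u - w)] holds. *)
Definition lexneg w :=
  exists2 i : 'I_N, w 0 i < 0 & forall j : 'I_N, (j < i)%N -> w 0 j = 0.

Lemma lexneg0 : ~ lexneg 0.
Proof. by case=> i; rewrite mxE ltxx. Qed.

Lemma lexnegD u v : lexneg u -> lexneg v -> lexneg (u + v).
Proof.
case=> i ui uj [j vj vi]; have [ij|ji|/val_inj ij] := ltngtP i j.
- exists i => [|l li]; rewrite mxE; first by rewrite vi // addr0.
  by rewrite uj // vi ?addr0 //; apply: ltn_trans ij.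
- exists j => [|l lj]; rewrite mxE; first by rewrite uj // add0r.
  by rewrite vi // uj ?addr0 //; apply: ltn_trans ji.
- exists i => [|l li]; rewrite mxE; first by rewrite -ij in vj; lra.
  by rewrite uj // vi ?addr0 // -ij.
Qed.

Lemma lexnegZ (c : R) w : 0 < c -> lexneg w -> lexneg (c *: w).
Proof.
move=> c0 [i wi wj]; exists i => [|j ji]; rewrite mxE.
  by rewrite pmulr_rlt0.
by rewrite wj // mulr0.
Qed.

Lemma lexneg_total w : w != 0 -> lexneg w \/ lexneg (- w).
Proof.
move=> w0; have [i0 wi0] : exists i, w 0 i != 0.
  apply/existsP; apply: contraR w0 => /existsPn w0.
  by apply/eqP/rowP => i; rewrite mxE; apply/eqP; move: (w0 i); rewrite negbK.
have [i wi imin] := @arg_minnP _ i0 (fun i => w 0 i != 0) val wi0.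
have wj (j : 'I_N) : (j < i)%N -> w 0 j = 0.
  by move=> ji; apply: contraTeq ji => /imin; rewrite -leqNgt.
move: wi; rewrite neq_lt => /orP[wi|wi]; [left|right]; exists i => //.
  by rewrite mxE oppr_lt0.
by move=> j ji; rewrite mxE wj // oppr0.
Qed.

Definition supp w := [set i | w 0 i != 0]%SET.

Lemma notin_supp w i : i \notin supp w -> w 0 i = 0.
Proof. by rewrite finset.in_set negbK => /eqP. Qed.

Lemma suppP w (C : {set 'I_N}) :
  reflect (forall i, i \notin C -> w 0 i = 0) (supp w \subset C).
Proof.
apply: (iffP fintype.subsetP) => [wC i|wC i]; last first.
  by rewrite inE; apply: contraNT => /wC/eqP.
by apply: contraNeq => wi; apply: wC; rewrite inE.
Qed.

Lemma supp_linear (C : {set 'I_N}) (c : R) u v :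
  supp u \subset C -> supp v \subset C -> supp (u + c *: v) \subset C.
Proof.
move=> /suppP uC /suppP vC; apply/suppP => i iC.
by rewrite !mxE uC // vC // mulr0 addr0.
Qed.

(** Used to move from [w] a little way along a vector supported in [supp w] without losing
    non-negativity. *)
Lemma small_multiple u w : (forall i, 0 <= w 0 i) -> supp u \subset supp w ->
  exists2 c : R, 0 < c & forall i, c * u 0 i <= w 0 i.
Proof.
move=> w0 /suppP uw.
suff [c c0 H] : exists2 c : R, 0 < c &
    forall i, i \in enum 'I_N -> c * u 0 i <= w 0 i.
  by exists c => // i; apply: H; rewrite mem_enum.
elim: (enum 'I_N) => [|i l [c c0 IH]]; first by exists 1.
have [wi|wi] := eqVneq (w 0 i) 0.
  exists c => // j; rewrite inE => /predU1P[->|/IH//].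
  by rewrite uw ?mulr0 ?w0 // inE wi eqxx.
have {}wi : 0 < w 0 i by rewrite lt_def wi w0.
have u1 : 0 < 1 + `|u 0 i| by rewrite ltr_pwDl.
pose e := w 0 i / (1 + `|u 0 i|).
have e0 : 0 < e by rewrite divr_gt0.
exists (Num.min c e) => [|j]; first by rewrite lt_min c0 e0.
have m0 : 0 <= Num.min c e by rewrite le_min !ltW.
rewrite inE => /predU1P[->|jl].
  apply: (@le_trans _ _ (e * (1 + `|u 0 i|))); last by rewrite divfK ?gt_eqF.
  apply: (@le_trans _ _ (Num.min c e * (1 + `|u 0 i|))).
    by rewrite ler_wpM2l // ler_wpDl // ler_norm.
  by rewrite (ler_wpM2r (ltW u1)) // ge_min lexx orbT.
have [uj|uj] := leP 0 (u 0 j).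
  by rewrite (le_trans _ (IH j jl)) // ler_wpM2r // ge_min lexx.
by rewrite (le_trans _ (w0 j)) // mulr_ge0_le0 // ltW.
Qed.

End Weights.

(** * Lexicographically least weights *)

Section Reduced.
Variables (R : realType) (N m : nat) (B : 'M[R]_(N, m)).
Variable cell : {set 'I_N} -> Prop.
Implicit Types u v w : 'rV[R]_N.

Definition admissible w :=
  (forall i, 0 <= w 0 i) /\ exists2 C, cell C & supp w \subset C.

(** Combinatorial form of the requirement that cells meet in common faces: a point carried by [C]
    gets no admissible weights outside [C]. *)
Definition cells_compatible := forall w u C,
  (forall i, 0 <= w 0 i) -> cell C -> supp w \subset C ->
  admissible u -> u *m B = w *m B -> supp u \subset C.

Definition reduced w := admissible w /\
  forall u, admissible u -> u *m B = w *m B -> ~ lexneg (u - w).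

Definition independent (C : {set 'I_N}) :=
  forall v, supp v \subset C -> v *m B = 0 -> v = 0.

Lemma reduced_inj w u : reduced w -> reduced u -> u *m B = w *m B -> u = w.
Proof.
move=> [aw rw] [au ru] E; apply/eqP; rewrite -subr_eq0; apply/negP => /negP.
case/lexneg_total => [|H]; first exact: rw.
by apply: (ru w); rewrite // -opprB.
Qed.

(** Of a nonzero relation and its negative, one is [lexneg]; a small multiple of it added to [w]
    would give smaller weights of the same point. *)
Lemma reduced_independent w : reduced w -> independent (supp w).
Proof.
move=> [[w0 [C cC wC]] rw].
suff H v : supp v \subset supp w -> v *m B = 0 -> ~ lexneg v.
  move=> v vw vB; apply/eqP/negPn/negP => /lexneg_total[|]; first exact: H.
  apply: H; last by rewrite mulNmx vB oppr0.
  by apply/suppP => i iw; rewrite mxE (suppP _ _ vw) // oppr0.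
move=> vw vB nv.
have nvw : supp (- v) \subset supp w.
  by apply/suppP => i iw; rewrite mxE (suppP _ _ vw) // oppr0.
have [c c0 cv] := small_multiple w0 nvw.
apply: (rw (w + c *: v)).
- split=> [i|]; first by have := cv i; rewrite !mxE; lra.
  by exists C => //; apply: supp_linear => //; apply: fintype.subset_trans wC.
- by rewrite mulmxDl -scalemxAl vB scaler0 addr0.
- by rewrite addrAC subrr add0r; apply: lexnegZ.
Qed.

(** Smaller weights [v] for the point of [u] would make [w + c *: (v - u)] smaller than [w].
    Compatibility keeps [v] in the cell of [w], so this competitor is admissible. *)
Lemma reduced_sub w u : cells_compatible -> reduced w ->
  (forall i, 0 <= u 0 i) -> supp u \subset supp w -> reduced u.
Proof.
move=> cB [[w0 [C cC wC]] rw] u0 uw.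
have uC : supp u \subset C by exact: fintype.subset_trans wC.
split; first by split=> //; exists C.
move=> v av E nv; have vC := cB _ _ _ u0 cC uC av E.
have [c c0 cv] := small_multiple w0 uw.
apply: (rw (w + c *: (v - u))).
- split=> [i|].
    have := cv i; have := mulr_ge0 (ltW c0) (av.1 i); rewrite !mxE; lra.
  exists C => //; apply: supp_linear => //.
  by rewrite -[- u]scaleN1r; apply: supp_linear.
- by rewrite mulmxDl -scalemxAl mulmxBl E subrr scaler0 addr0.
- by rewrite addrAC subrr add0r; apply: lexnegZ.
Qed.

(** Caratheodory's reduction along lexicographically negative relations only: each step shrinks the
    support and lowers the weights. *)
Lemma lex_caratheodory w : admissible w ->
  exists u, [/\ admissible u, independent (supp u), u *m B = w *m B &
                u = w \/ lexneg (u - w)].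
Proof.
have [k] := ubnP #|supp w|; elim: k w => // k IH w wk aw.
have [iw|] := pselect (independent (supp w)); first by exists w; split=> //; left.
have [w0 [C cC wC]] := aw.
move=> niw; have [v [vw vB nv]] :
    exists v, [/\ supp v \subset supp w, v *m B = 0 & lexneg v].
  apply: contrapT => H; apply: niw => v vw vB.
  apply/eqP/negPn/negP => /lexneg_total[|] nv; apply: H; first by exists v.
  exists (- v); split=> //; last by rewrite mulNmx vB oppr0.
  by apply/suppP => i iw; rewrite mxE (suppP _ _ vw) // oppr0.
have [i0 vi0 _] := nv.
(* Ratio test: the largest step along [v] that keeps all weights non-negative makes some entry
   vanish. It exists because a [lexneg] vector has a negative entry. *)
pose F i := w 0 i / - v 0 i.
have [i vi imin] := @arg_minP _ _ _ i0 (fun i => v 0 i < 0) F vi0.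
have wpos j : v 0 j < 0 -> 0 < w 0 j.
  move=> vj; rewrite lt_def w0 andbT; apply: contraTN vj => wj.
  by rewrite (suppP _ _ vw) ?ltxx // inE negbK.
have t0 : 0 < F i by rewrite divr_gt0 ?oppr_gt0 ?wpos.
pose u := w + F i *: v.
have u0 j : 0 <= u 0 j.
  rewrite !mxE; have [vj|vj] := leP 0 (v 0 j).
    by rewrite addr_ge0 // mulr_ge0 // ltW.
  have := imin j vj; rewrite /F ler_pdivlMr ?oppr_gt0 //; lra.
have uw : supp u \subset supp w by exact: supp_linear.
have ui : u 0 i = 0.
  by rewrite !mxE /F invrN mulrN mulNr divfK ?subrr // lt_eqF.
have ku : (#|supp u| < k)%N.
  move: wk; rewrite ltnS; apply: leq_trans; apply: proper_card.
  apply/fintype.properP; split=> //.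
  by exists i; rewrite inE ?ui ?eqxx // gt_eqF // wpos.
have au : admissible u by split=> //; exists C => //; apply: fintype.subset_trans wC.
have [u' [au' iu' u'B H]] := IH u ku au.
have uB : u *m B = w *m B by rewrite mulmxDl -scalemxAl vB scaler0 addr0.
have nuw : lexneg (u - w) by rewrite /u addrAC subrr add0r; apply: lexnegZ.
exists u'; split=> //; first by rewrite u'B.
right; case: H => [->//|H].
by rewrite -[u'](subrK u) -addrA; apply: lexnegD.
Qed.

(* Independent weights over a point are determined by their supports, so the
   descent of [lex_caratheodory] can only be repeated finitely often. *)
Lemma reduced_ex w : admissible w -> exists2 u, reduced u & u *m B = w *m B.
Proof.
pose below w := [set S : {set 'I_N} | `[< exists u,
  [/\ admissible u, independent (supp u), u *m B = w *m B,
      lexneg (u - w) & supp u = S] >]]%SET.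
have [k] := ubnP #|below w|; elim: k w => // k IH w wk aw.
have [rw|] := pselect (reduced w); first by exists w.
move=> nrw; have [v [av vB nv]] :
    exists v, [/\ admissible v, v *m B = w *m B & lexneg (v - w)].
  by apply: contrapT => H; apply: nrw; split=> // v av vB nv; apply: H; exists v.
have [u [au iu uB uv]] := lex_caratheodory av.
have nu : lexneg (u - w).
  case: uv => [->//|uv]; rewrite -[u](subrK v) -addrA; exact: lexnegD.
rewrite vB in uB.
have ku : (#|below u| < k)%N.
  move: wk; rewrite ltnS; apply: leq_trans; apply: proper_card.
  apply/fintype.properP; split.
    apply/fintype.subsetP => S; rewrite !finset.in_set => /asboolP[x [ax ix xB nx xS]].
    apply/asboolP; exists x; split=> //; first by rewrite xB.
    by rewrite -[x](subrK u) -addrA; apply: lexnegD.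
  exists (supp u); rewrite finset.in_set; first by apply/asboolP; exists u.
  apply/negP => /asboolP[x [ax ix xB nx xS]].
  suff xu : x - u = 0 by rewrite xu in nx; apply: lexneg0 nx.
  apply: iu; last by rewrite mulmxBl xB subrr.
  by rewrite -[- u]scaleN1r; apply: supp_linear; rewrite ?xS.
by have [x rx xB] := IH u ku au; exists x => //; rewrite xB.
Qed.

End Reduced.

(** * Farkas' lemma *)

Section Farkas.
Variables (R : realType) (m : nat).
Implicit Types a b x y : 'rV[R]_m.

Lemma dotvC a x : dotv a x = dotv x a.
Proof. by apply: eq_bigr => i _; rewrite mulrC. Qed.

Lemma dotvDr a x y : dotv a (x + y) = dotv a x + dotv a y.
Proof. by rewrite /dotv -big_split; apply: eq_bigr => i _; rewrite mxE mulrDr. Qed.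

Lemma dotvZr a (c : R) x : dotv a (c *: x) = c * dotv a x.
Proof. by rewrite /dotv mulr_sumr; apply: eq_bigr => i _; rewrite mxE mulrCA. Qed.

Lemma dotv_sumr (I : Type) (r : seq I) (f : I -> 'rV[R]_m) a :
  dotv a (\sum_(i <- r) f i) = \sum_(i <- r) dotv a (f i).
Proof.
elim/big_rec2: _ => [|i y x _ <-]; last exact: dotvDr.
by apply: big1 => i _; rewrite mxE mulr0.
Qed.

Lemma dotv_le0 x : dotv x x <= 0 -> x = 0.
Proof.
move=> x0; apply/rowP => i; rewrite mxE; apply/eqP.
rewrite -sqrf_eq0 expr2 eq_le sqr_ge0 andbT (le_trans _ x0) //.
rewrite /dotv (bigD1 i) //= lerDl; apply: sumr_ge0 => j _; exact: sqr_ge0.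
Qed.

(* Bartl's induction: a functional [a] violating the conclusion without the
   first generator is used to project all other vectors along it. *)
Lemma farkas (I : eqType) (l : seq I) (f : I -> 'rV[R]_m) y : uniq l ->
  (forall a, (forall i, i \in l -> dotv a (f i) <= 0) -> dotv a y <= 0) ->
  exists2 w : I -> R, (forall i, 0 <= w i) & y = \sum_(i <- l) w i *: f i.
Proof.
elim: l f y => [|i0 l IH] f y /= ul H.
  exists (fun=> 0) => //; rewrite big_nil; apply: dotv_le0; exact: H.
case/andP: ul => i0l ul.
have neq i : i \in l -> (i == i0) = false by move=> il; apply: contraNF i0l => /eqP <-.
have [Hl|] := pselect (forall a,
    (forall i, i \in l -> dotv a (f i) <= 0) -> dotv a y <= 0).
  have [w w0 ->] := IH f y ul Hl.
  exists (fun i => if i == i0 then 0 else w i) => [i|]; first by case: ifP.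
  rewrite big_cons eqxx scale0r add0r; apply: eq_big_seq => i il.
  by rewrite neq.
move=> /existsNP[a /not_implyP[fa /negP]]; rewrite -ltNge => ya.
have i0a : 0 < dotv a (f i0).
  rewrite ltNge; apply/negP => i0a; move: ya; rewrite ltNge => /negP; apply.
  by apply: H => i; rewrite inE => /predU1P[->|/fa].
pose c x := dotv a x / dotv a (f i0).
pose pr x := x - c x *: f i0.
have dpr b x : dotv b (pr x) = dotv (b - (dotv b (f i0) / dotv a (f i0)) *: a) x.
  rewrite /pr -scaleNr dotvDr dotvZr [RHS]dotvC -scaleNr dotvDr dotvZr.
  by rewrite ![dotv x _]dotvC /c; ring.
have [|w w0 E] := IH (pr \o f) (pr y) ul.
  move=> b Hb; rewrite dpr; apply: H => i; rewrite inE => /predU1P[->|/Hb].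
    by rewrite -dpr /pr /c divff ?gt_eqF // scale1r subrr -(scale0r 0) dotvZr mul0r.
  by rewrite /= dpr.
(* The weight of [i0] restores the multiples of [f i0] removed by the projection; it is non-negative
   because [a] is positive on [y] and [f i0] and at most 0 on the other generators. *)
exists (fun i => if i == i0 then c y - \sum_(i <- l) w i * c (f i) else w i).
  move=> i; case: ifP => // _; rewrite subr_ge0; apply: (@le_trans _ _ 0).
    rewrite big_seq; apply: sumr_le0 => j jl.
    by rewrite mulr_ge0_le0 // /c mulr_le0_ge0 ?fa // invr_ge0 ltW.
  by rewrite /c divr_ge0 // ltW.
rewrite big_cons eqxx.
have -> : \sum_(j <- l) (if j == i0 then c y - \sum_(i <- l) w i * c (f i)
    else w j) *: f j = \sum_(j <- l) w j *: f j.
  by apply: eq_big_seq => j jl; rewrite neq.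
move/eqP: E; rewrite subr_eq => /eqP E; rewrite [LHS]E {E}.
have -> : \sum_(i <- l) w i *: (pr \o f) i =
    \sum_(i <- l) w i *: f i - (\sum_(i <- l) w i * c (f i)) *: f i0.
  rewrite scaler_suml -sumrB; apply: eq_bigr => i _.
  by rewrite /= /pr scalerBr scalerA.
by rewrite scalerBl addrC addrCA addrC.
Qed.

End Farkas.

(** * Polytopes as hulls of their vertices *)

Section Hull.
Variables (R : realType) (n : nat).
Local Open Scope classical_set_scope.

(** The matrix stays fixed while [J] varies, so that generators can be discarded without renumbering
    the weights. *)
Definition hull q (M : 'M[R]_(q, n)) (J : {set 'I_q}) : set 'rV[R]_n :=
  [set x | exists w : 'rV[R]_q, [/\ forall i, 0 <= w 0 i, \sum_i w 0 i = 1,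
     supp w \subset J & x = w *m M]].

Lemma conv_hullE (s : seq 'rV[R]_n) :
  conv_hull s = hull (\matrix_(i < size s) s`_i) [set: 'I_(size s)]%SET.
Proof.
apply/seteqP; split=> x.
  move=> [w [w0 w1 xE]]; exists (\row_i w i); split=> [i|||]; rewrite ?mxE ?subsetT //.
    by rewrite -w1; apply: eq_bigr => i _; rewrite mxE.
  by rewrite mulmx_sum_row xE; apply: eq_bigr => i _; rewrite rowK mxE.
move=> [w [w0 w1 _ ->]]; exists (w 0); split=> //.
by rewrite mulmx_sum_row; apply: eq_bigr => i _; rewrite rowK.
Qed.

Lemma hull_row q (M : 'M[R]_(q, n)) (J : {set 'I_q}) i :
  i \in J -> hull M J (row i M).
Proof.
move=> iJ; exists (delta_mx 0 i); split=> [j|||].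
- by rewrite mxE ler0n.
- rewrite (bigD1 i) //= mxE !eqxx big1 ?addr0 // => j ji.
  by rewrite mxE (negPf ji).
- by apply/suppP => j jJ; rewrite mxE /=; case: eqVneq jJ => // ->; rewrite iJ.
- by rewrite rowE.
Qed.

Lemma hull_trans q q' (M : 'M[R]_(q, n)) (M' : 'M[R]_(q', n))
    (J : {set 'I_q}) (J' : {set 'I_q'}) :
  (forall i, i \in J -> hull M' J' (row i M)) -> hull M J `<=` hull M' J'.
Proof.
move=> H x [w [w0 w1 wJ ->]].
(* Outside [J] the chosen weights are arbitrary, but there [w] vanishes; [wi] records this
   alternative. *)
have /choice[W HW] i : exists v : 'rV[R]_q', i \in J ->
    [/\ forall j, 0 <= v 0 j, \sum_j v 0 j = 1,
        supp v \subset J' & row i M = v *m M'].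
  by have [/H[v Hv]|] := boolP (i \in J); [exists v|exists 0].
have wi i (P : Prop) : (i \in J -> P) -> w 0 i = 0 \/ P.
  have [iJ|iJ] := boolP (i \in J); last by left; apply: (suppP _ _ wJ).
  by move=> /(_ isT); right.
exists (w *m \matrix_i W i); split.
- move=> j; rewrite mxE; apply: sumr_ge0 => i _; rewrite mxE.
  by have [->|[Wi0 _ _ _]] := wi i _ (HW i); rewrite ?mul0r // mulr_ge0.
- rewrite -w1; under eq_bigr do rewrite mxE.
  rewrite exchange_big /=; apply: eq_bigr => i _; rewrite -mulr_sumr.
  have [->|[_ Wi1 _ _]] := wi i _ (HW i); first by rewrite !mul0r.
  by under eq_bigr do rewrite mxE; rewrite Wi1 mulr1.
- apply/suppP => j jJ; rewrite mxE big1 // => i _; rewrite mxE.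
  have [->|[_ _ WiJ _]] := wi i _ (HW i); first by rewrite mul0r.
  by rewrite (suppP _ _ WiJ) ?mulr0.
- rewrite -mulmxA !mulmx_sum_row; apply: eq_bigr => i _.
  have [->|[_ _ _ E]] := wi i _ (HW i); first by rewrite !scale0r.
  by rewrite row_mul rowK E.
Qed.

(** Farkas' lemma for homogenized points: the appended coordinate 1 forces the weights to sum to 1
    and adds a constant term to the functional. *)
Lemma hull_separation q (M : 'M[R]_(q, n)) (J : {set 'I_q}) x :
  ~ hull M J x -> exists a, forall i, i \in J -> dotv a (row i M) < dotv a x.
Proof.
move=> nx; apply: contrapT => nH; apply: nx.
pose lift y : 'rV[R]_(n + 1) := row_mx y 1.
have dlift a y : dotv a (lift y) = dotv (lsubmx a) y + rsubmx a 0 0.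
  rewrite /dotv big_split_ord /= big_ord1 row_mxEr !mxE mulr1; congr (_ + _).
  by apply: eq_bigr => i _; rewrite row_mxEl mxE.
have [||w w0 E] := @farkas R (n + 1) _ (enum J) (fun i => lift (row i M)) (lift x).
- exact: enum_uniq.
- move=> a Ha; rewrite leNgt; apply/negP => xa; apply: nH.
  exists (lsubmx a) => i iJ; have := Ha i; rewrite mem_enum => /(_ iJ).
  by move: xa; rewrite !dlift; lra.
exists (\row_i (if i \in J then w i else 0)); split.
- by move=> i; rewrite mxE; case: ifP.
- under eq_bigr do rewrite mxE.
  rewrite -big_mkcond /=; move/rowP: E => /(_ (rshift n 0)).
  rewrite row_mxEr mxE summxE big_enum /= => E1.
  apply: etrans (esym E1); apply: eq_bigr => i _.
  by rewrite mxE row_mxEr mxE mulr1.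
- by apply/suppP => i /negPf iJ; rewrite mxE iJ.
- apply/rowP => j; move/rowP: E => /(_ (lshift 1 j)).
  rewrite row_mxEl summxE big_enum /= => ->; rewrite mxE big_mkcond /=.
  apply: eq_bigr => i _; rewrite [X in _ = X * _]mxE.
  by case: ifP; rewrite ?mul0r // => _; rewrite mxE row_mxEl mxE.
Qed.

(** A generating set [J] of least cardinality works: the hull of the other rows misses row [j], and
    a functional separating the two attains its maximum on the whole hull at row [j] only. *)
Lemma hull_vertices q (M : 'M[R]_(q, n)) :
  exists2 J : {set 'I_q}, hull M [set: 'I_q]%SET = hull M J &
    forall j, j \in J -> vertex (hull M [set: 'I_q]%SET) (row j M).
Proof.
pose gen (J : {set 'I_q}) := `[< forall i, hull M J (row i M) >].
have genT : gen [set: 'I_q]%SET.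
  by apply/asboolP => i; apply: hull_row; rewrite finset.in_setT.
have [J /asboolP gJ Jmin] := @arg_minnP _ _ gen (fun J => #|J|) genT.
have TJ : hull M [set: 'I_q]%SET = hull M J.
  by apply/seteqP; split; apply: hull_trans => i _ //; apply: hull_row;
     rewrite finset.in_setT.
exists J => // j jJ; rewrite TJ.
have /hull_separation[a Ha] : ~ hull M (J :\ j)%SET (row j M).
  move=> jM; have : gen (J :\ j)%SET.
    apply/asboolP => i; apply: hull_trans (gJ i) => l lJ.
    have [->//|lj] := eqVneq l j; apply: hull_row.
    by rewrite finset.in_setD1 lj.
  by move=> /Jmin; rewrite (cardsD1 j J) jJ add1n ltnn.
(* The gap to the maximum is the weighted sum of the gaps at the rows; on [J] these are non-negative
   and vanish only at [j], so gap 0 puts all weight on [j]. *)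
have dE (w : 'rV[R]_q) : \sum_i w 0 i = 1 -> dotv a (row j M) - dotv a (w *m M) =
    \sum_i w 0 i * (dotv a (row j M) - dotv a (row i M)).
  move=> w1; rewrite mulmx_sum_row dotv_sumr.
  under [RHS]eq_bigr do rewrite mulrBr.
  rewrite sumrB -mulr_suml w1 mul1r; congr (_ - _).
  by apply: eq_bigr => i _; rewrite dotvZr.
have term (w : 'rV[R]_q) i : (forall i, 0 <= w 0 i) -> supp w \subset J ->
    0 <= w 0 i * (dotv a (row j M) - dotv a (row i M)).
  move=> w0 /suppP wJ; have [->|ij] := eqVneq i j; first by rewrite subrr mulr0.
  have [iJ|iJ] := boolP (i \in J); last by rewrite wJ // mul0r.
  by rewrite mulr_ge0 // subr_ge0 ltW // Ha // finset.in_setD1 ij.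
exists a, (dotv a (row j M)); split=> [x [w [w0 w1 wJ ->]]|].
  by rewrite -subr_ge0 dE //; apply: sumr_ge0 => i _; apply: term.
apply/seteqP; split=> [_ -> /=|x [[w [w0 w1 wJ ->]] /= ax]].
  by split; first exact: hull_row.
have {}ax : \sum_i w 0 i * (dotv a (row j M) - dotv a (row i M)) = 0.
  by rewrite -dE // ax subrr.
have wi i : i != j -> w 0 i = 0.
  move=> ij; have [iJ|iJ] := boolP (i \in J); last by apply: (suppP _ _ wJ).
  move/eqP: ax; rewrite psumr_eq0 => [/allP/(_ i)|l _]; last exact: term.
  rewrite mem_index_enum => /(_ isT); rewrite /= mulf_eq0 => /orP[/eqP//|].
  by rewrite gt_eqF // subr_gt0 Ha // finset.in_setD1 ij.
have wj : w 0 j = 1.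
  by rewrite -w1 (bigD1 j) //= big1 ?addr0.
rewrite mulmx_sum_row (bigD1 j) //= wj scale1r big1 ?addr0 // => i /wi ->.
by rewrite scale0r.
Qed.

End Hull.

(** * Dimension of a polytope *)

Local Open Scope classical_set_scope.

(** The direction space is spanned by the differences of the generators from [x0]. It is returned
    with its containment property so that free families of differences can be bounded by its
    dimension. *)
Lemma polytope_set_dim (R : realType) n (P : set 'rV[R]_n) x0 :
  polytope P -> P x0 ->
  exists2 U : {vspace 'rV[R]_n}, (forall x y, P x -> P y -> x - y \in U) &
    set_dim P (\dim U).
Proof.
move=> [s ->]; rewrite conv_hullE; set M := (\matrix_i _).
set q := size s in M *; set J := [set: _]%SET => Px0.
pose X := [tuple row i M - x0 | i < q].
have XE (i : 'I_q) : X`_i = row i M - x0 by exact: nth_mktuple.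
have PX x : hull M J x -> x - x0 \in <<X>>%VS.
  move=> [w [_ w1 _ ->]]; rewrite mulmx_sum_row -[x0]scale1r -w1 scaler_suml.
  rewrite -sumrB; apply: memv_suml => i _; rewrite -scalerBr memvZ //.
  by apply: memv_span; apply/mapP; exists i; rewrite ?mem_enum.
exists <<X>>%VS.
  move=> x y Px Py; have -> : x - y = (x - x0) - (y - x0).
    by rewrite opprB addrA subrK.
  by rewrite memvB // PX.
exists x0, <<X>>%VS; split=> //; apply/seteqP; split=> x.
  move=> [k [a [w [Pa w1 ->]]]]; exists (\sum_i w i *: (a i - x0)).
    by apply: memv_suml => i _; rewrite memvZ // PX.
  under eq_bigr do rewrite scalerBr.
  by rewrite sumrB -scaler_suml w1 scale1r addrC subrK.
move=> [u /= uX <-]; have uE := @coord_span _ _ _ X u uX.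
pose c i := coord X i u.
(* Index 0 carries the base point [x0], whose weight brings the total to 1. *)
exists q.+1, (fun i => if unlift ord0 i is Some j then row j M else x0).
exists (fun i => if unlift ord0 i is Some j then c j else 1 - \sum_i c i).
split.
- move=> i; case: unliftP => [j _|_] //; apply: hull_row.
  by rewrite finset.in_setT.
- rewrite big_ord_recl unlift_none.
  by under [X in _ + X]eq_bigr do rewrite liftK; rewrite subrK.
- rewrite big_ord_recl unlift_none; under [X in _ = _ + X]eq_bigr do rewrite liftK.
  rewrite {1}uE; under [X in _ + X = _]eq_bigr do rewrite XE scalerBr.
  rewrite sumrB -scaler_suml scalerBl scale1r -/(c _).
  by rewrite addrA addrAC.
Qed.

(** * Cells of the complex and their reduced weights *)

Section Cells.
Variables (R : realType) (n : nat) (K : set (set 'rV[R]_n)).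
Variables (N : nat) (A : 'M[R]_(N, n)).

(** The column of ones makes the image of a weight vector record its total, the height in the cone
    over |K|, besides the point. *)
Definition homog : 'M[R]_(N, n + 1) := row_mx A (const_mx 1).

Definition cell (C : {set 'I_N}) :=
  exists2 P, K P & C = [set i | `[< P (row i A) >]]%SET.

Lemma homog_eq (u w : 'rV[R]_N) : u *m homog = w *m homog <->
  u *m A = w *m A /\ \sum_i u 0 i = \sum_i w 0 i.
Proof.
have sumE (v : 'rV[R]_N) : v *m const_mx 1 = (\sum_i v 0 i)%:M :> 'M[R]_1.
  apply/matrixP => i j; rewrite !ord1 !mxE eqxx mulr1n.
  by apply: eq_bigr => l _; rewrite mxE mulr1.
rewrite !mul_mx_row !sumE; split; last by case=> -> ->.
move/eq_row_mx => [-> /matrixP/(_ 0 0)].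
by rewrite !mxE !mulr1n.
Qed.

Hypothesis complexK : polytopal_complex K.
Hypothesis integralK : integral_complex K.
Hypothesis rowsA : forall x, lattice x -> complex_support K x ->
  exists i, x = row i A.

Lemma in_cell P i : (i \in [set i | `[< P (row i A) >]]%SET) <-> P (row i A).
Proof. by rewrite finset.in_set; split=> /asboolP. Qed.

(** By integrality every vertex of [P] is a lattice point of |K|, hence a row of [A], and a polytope
    is the hull of its vertices. *)
Lemma cell_hull P : K P -> P = hull A [set i | `[< P (row i A) >]]%SET.
Proof.
move=> KP; have [_ polK _ _] := complexK; have [s sE] := polK _ KP.
move: sE; rewrite conv_hullE; set M := (\matrix_i _) => PE.
apply/seteqP; split; last first.
  by rewrite [X in _ `<=` X]PE; apply: hull_trans => i /in_cell; rewrite {1}PE.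
have [J MJ Jv] := hull_vertices M.
rewrite [X in X `<=` _]PE MJ; apply: hull_trans => j jJ.
have Pj : P (row j M) by rewrite PE MJ; apply: hull_row.
have Lj : lattice (row j M) by apply: (integralK KP); rewrite PE; apply: Jv.
have [|i iE] := rowsA Lj; first by exists P.
by rewrite iE; apply: hull_row; apply/in_cell; rewrite -iE.
Qed.

Lemma cell_mulmx P (w : 'rV[R]_N) : K P -> (forall i, 0 <= w 0 i) ->
  supp w \subset [set i | `[< P (row i A) >]]%SET -> 0 < \sum_i w 0 i ->
  P ((\sum_i w 0 i)^-1 *: (w *m A)).
Proof.
move=> KP w0 wP s0; rewrite (cell_hull KP).
exists ((\sum_i w 0 i)^-1 *: w); split.
- by move=> i; rewrite mxE mulr_ge0 // invr_ge0 ltW.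
- by under eq_bigr do rewrite mxE; rewrite -mulr_sumr mulVf // gt_eqF.
- by apply/suppP => i iP; rewrite mxE (suppP _ _ wP) // mulr0.
- by rewrite scalemxAl.
Qed.

(** Scaled to total weight 1, the common point lies in [P] and [Q], hence on a face of [Q]. The
    inequality of this face is tight at the point, so it is tight at every row in the support of
    [u], and these rows lie in [P]. *)
Lemma cell_compatible : cells_compatible homog cell.
Proof.
move=> w u _ w0 [P KP ->] wP [u0 [_ [Q KQ ->] uQ]] /homog_eq[uA us].
have [s0|s0] := eqVneq (\sum_i u 0 i) 0.
  apply/suppP => i _; move/eqP: s0; rewrite psumr_eq0 => [/allP/(_ i)|//].
  by rewrite mem_index_enum => /(_ isT) /eqP.
have {}s0 : 0 < \sum_i u 0 i by rewrite lt_def s0 sumr_ge0.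
have Qx := cell_mulmx KQ u0 uQ s0.
have Px := cell_mulmx KP w0 wP; rewrite -us -uA in Px; have {}Px := Px s0.
have [_ _ _ /(_ _ _ KP KQ)[_ [a [b [Qb PQ]]]]] := complexK.
have : (P `&` Q) ((\sum_i u 0 i)^-1 *: (u *m A)) by [].
rewrite PQ => -[_ /=]; rewrite dotvZr => ab.
have {}ab : \sum_i u 0 i * (b - dotv a (row i A)) = 0.
  under eq_bigr do rewrite mulrBr.
  rewrite sumrB -mulr_suml -ab mulrA divff ?gt_eqF // mul1r mulmx_sum_row.
  by rewrite dotv_sumr -sumrB big1 // => i _; rewrite dotvZr subrr.
apply/fintype.subsetP => i iu; have /in_cell Qi := fintype.subsetP uQ i iu.
have : (P `&` Q) (row i A); last by case=> Pi _; apply/in_cell.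
rewrite PQ; split=> //=; apply/esym/eqP; rewrite -subr_eq0.
move/eqP: ab; rewrite psumr_eq0 => [/allP/(_ i)|j _]; last first.
  have [ju|ju] := boolP (j \in supp u).
    by rewrite mulr_ge0 // subr_ge0 Qb //; apply/in_cell/(fintype.subsetP uQ).
  by move: ju; rewrite finset.in_set negbK => /eqP ->; rewrite mul0r.
rewrite mem_index_enum => /(_ isT); rewrite /= mulf_eq0 => /orP[ui|//].
by move: iu; rewrite finset.in_set ui.
Qed.

(** With [reduced_inj], this makes the points of the dilate correspond bijectively to the reduced
    weights of total [k]. *)
Lemma lattice_dilate (k : nat) z : (0 < k)%N ->
  [set k%:R *: x | x in complex_support K] z <->
  exists w, [/\ reduced homog cell w, \sum_i w 0 i = k%:R & z = w *m A].
Proof.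
move=> k0; have k0R : 0 < k%:R :> R by rewrite ltr0n.
split=> [[x [P KP Px] <-]|[w [[[w0 [_ [P KP ->] wP]] _] wk ->]]].
  move: Px; rewrite (cell_hull KP) => -[w [w0 w1 wP ->]].
  have aw : admissible cell (k%:R *: w).
    split=> [i|]; first by rewrite mxE mulr_ge0 // ltW.
    exists [set i | `[< P (row i A) >]]%SET; first by exists P.
    by apply/suppP => i iP; rewrite mxE (suppP _ _ wP) // mulr0.
  have [u ru /homog_eq[uA us]] := reduced_ex homog aw.
  exists u; split=> //; last by rewrite uA scalemxAl.
  by rewrite us; under eq_bigr do rewrite mxE; rewrite -mulr_sumr w1 mulr1.
exists (k%:R^-1 *: (w *m A)).
  by exists P => //; rewrite -wk; apply: cell_mulmx => //; rewrite wk.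
by rewrite scalerA divff ?scale1r // gt_eqF.
Qed.

(** Independence of homogenized rows is affine independence, so the differences from one row of the
    support are free in the direction space of a single polytope. *)
Lemma card_supp_reduced d w : complex_dim K d -> reduced homog cell w ->
  (#|supp w| <= d.+1)%N.
Proof.
move=> [_ dimK] rw; have iw := reduced_independent rw.
have [[_ [_ [P KP ->] wP]] _] := rw.
have [->|[i0 i0w]] := set_0Vmem (supp w); first by rewrite cards0.
have inP i : i \in supp w -> P (row i A).
  by move=> iw'; apply/in_cell/(fintype.subsetP wP).
have [_ polK _ _] := complexK.
have [U UP dU] := polytope_set_dim (polK _ KP) (inP _ i0w).
rewrite (cardsD1 i0) i0w add1n ltnS (leq_trans _ (dimK _ _ KP dU)) //.
set D := (supp w :\ i0)%SET.
have inD i : i \in D -> i != i0 /\ i \in supp w by rewrite finset.in_setD1 => /andP.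
pose X := [tuple row (enum_val i) A - row i0 A | i < #|D|].
have XE (i : 'I_#|D|) : X`_i = row (enum_val i) A - row i0 A by exact: nth_mktuple.
have sXU : (<<X>> <= U)%VS.
  apply/span_subvP => _ /mapP[i _ ->]; apply: UP; apply: inP => //.
  by have [] := inD _ (enum_valP i).
suff fX : free X by rewrite -(size_tuple X) -(eqP fX) dimvS.
apply/freeP => c cX j.
(* A relation among the differences becomes a weight vector of total 0 on [supp w], to which
   independence applies. *)
pose v := \sum_l c l *: (delta_mx 0 (enum_val l) - delta_mx 0 i0) : 'rV[R]_N.
have vE i : v 0 i = \sum_l c l * ((i == enum_val l)%:R - (i == i0)%:R).
  by rewrite summxE; apply: eq_bigr => l _; rewrite !mxE.
have v0 : v = 0.
  apply: iw.
    apply/suppP => i iw'; rewrite vE big1 // => l _.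
    have [_ lw] := inD _ (enum_valP l).
    by rewrite !(negbTE (contraNneq _ iw')) ?subrr ?mulr0 // => ->.
  rewrite -(mul0mx _ homog); apply/homog_eq; split.
    rewrite mul0mx mulmx_suml; apply: etrans cX; apply: eq_bigr => l _.
    by rewrite -scalemxAl mulmxBl -!rowE XE.
  rewrite [RHS]big1 => [|i _]; last by rewrite mxE.
  under eq_bigr do rewrite vE.
  rewrite exchange_big big1 //= => l _; rewrite -mulr_sumr sumrB.
  have one t : \sum_i (i == t :> 'I_N)%:R = 1 :> R.
    by rewrite (bigD1 t) //= eqxx big1 ?addr0 // => i /negPf ->.
  by rewrite !one subrr mulr0.
move/rowP: v0 => /(_ (enum_val j)); rewrite vE mxE (bigD1 j) //= eqxx.
have [/negPf -> _] := inD _ (enum_valP j); rewrite subr0 mulr1.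
rewrite big1 ?addr0 // => l lj; rewrite (inj_eq enum_val_inj).
by rewrite eq_sym (negPf lj) subrr mulr0.
Qed.

End Cells.

(** * Compositions of an integer *)

(** Parts may be 0. Plain sequences let compositions of different lengths share one type; the
    bounded tuples provide the count. *)
Definition compositions (e r : nat) : seq (seq nat) :=
  [seq [seq val i | i <- val t] |
     t <- enum [set t : e.+1.-tuple 'I_r.+1 | (\sum_(i <- t) i)%N == r]%SET].

Lemma compositions_uniq e r : uniq (compositions e r).
Proof.
rewrite map_inj_uniq ?enum_uniq // => t t' /inj_map tt'.
by apply/val_inj/tt'; apply: val_inj.
Qed.

Lemma size_compositions e r : size (compositions e r) = 'C(e + r, e).
Proof. by rewrite size_map -cardE card_ord_partitions. Qed.

Lemma mem_compositions e r t :
  (t \in compositions e r) = (size t == e.+1) && (sumn t == r).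
Proof.
apply/mapP/andP => [[t' + ->]|[st /eqP tr]].
  rewrite mem_enum finset.in_set => t'r.
  by rewrite size_map size_tuple eqxx sumnE big_map.
have tle i : i \in t -> (i < r.+1)%N.
  move=> it; rewrite ltnS -tr sumnE (big_rem i) //=; exact: leq_addr.
have tE : [seq val i | i <- [seq inord i : 'I_r.+1 | i <- t]] = t.
  by rewrite -map_comp map_id_in // => i /tle it; rewrite /= inordK.
exists (map_tuple (inord : nat -> 'I_r.+1) (Tuple st)); last by rewrite -[LHS]tE.
by rewrite mem_enum finset.in_set -[X in _ == X]tr sumnE
  -[X in _ == (\sum_(i <- X) _)%N]tE !big_map.
Qed.

Lemma lattice_mulmx (R : realType) n N (A : 'M[R]_(N, n)) (w : 'rV[R]_N) :
  (forall i, lattice (row i A)) -> (forall i, w 0 i \is a Num.int) ->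
  lattice (w *m A).
Proof.
move=> Al wi j; rewrite mxE; apply: rpred_sum => i _.
by apply: rpredM => //; have := Al i j; rewrite mxE.
Qed.

Lemma latticeB (R : realType) n (x y : 'rV[R]_n) :
  lattice x -> lattice y -> lattice (x - y).
Proof. by move=> xl yl i; rewrite !mxE rpredB. Qed.

Lemma latticeD (R : realType) n (x y : 'rV[R]_n) :
  lattice x -> lattice y -> lattice (x + y).
Proof. by move=> xl yl i; rewrite !mxE rpredD. Qed.

(** * Integer shifts along a support *)

Section Shift.
Variables (R : realType) (N : nat).
Implicit Types (u : 'rV[R]_N) (t : seq nat).

(** [t] lists increments in the order of [enum (supp u)]; off the support the index runs past a [t]
    of matching length and the default 0 is read. *)
Definition shift_at u t (i : 'I_N) : nat := nth 0%N t (index i (enum (supp u))).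

Definition shift u t : 'rV[R]_N := \row_i (shift_at u t i)%:R.

Lemma shift_out u t i : size t = #|supp u| -> i \notin supp u ->
  shift_at u t i = 0%N.
Proof.
move=> st iu; rewrite /shift_at nth_default // st cardE.
by rewrite leqNgt index_mem mem_enum.
Qed.

Lemma map_shift_at u t : size t = #|supp u| ->
  [seq shift_at u t i | i <- enum (supp u)] = t.
Proof.
move=> st; apply: (@eq_from_nth _ 0%N); rewrite size_map -cardE // => j ju.
have [i0 i0u] : exists i, i \in supp u by apply/card_gt0P; apply: leq_ltn_trans ju.
rewrite (nth_map i0) -?cardE // /shift_at index_uniq ?enum_uniq // -?cardE //.
Qed.

Lemma sum_shift u t : size t = #|supp u| -> \sum_i shift u t 0 i = (sumn t)%:R.
Proof.
move=> st; rewrite -[in RHS](map_shift_at st) sumnE big_map big_enum /= natr_sum.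
rewrite [RHS]big_mkcond /=; apply: eq_bigr => i _; rewrite mxE.
by case: ifPn => // iu; rewrite shift_out.
Qed.

Lemma shift_map u (m : 'I_N -> nat) i : i \in supp u ->
  shift_at u [seq m i | i <- enum (supp u)] i = m i.
Proof.
move=> iu; rewrite /shift_at (nth_map i) ?nth_index ?mem_enum //.
by rewrite index_mem mem_enum.
Qed.

End Shift.

(** Two numbers in (0, 1] differ by less than 1. The zero alternative covers entries off the
    support, which are never shifted. *)
Lemma unit_part_inj (R : realType) (x y : R) (a b : nat) :
  (x = 0 /\ a = 0%N) \/ 0 < x <= 1 -> (y = 0 /\ b = 0%N) \/ 0 < y <= 1 ->
  x + a%:R = y + b%:R -> x = y /\ a = b.
Proof.
have a0 : 0 <= a%:R :> R by [].
have b0 : 0 <= b%:R :> R by [].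
case=> [[-> ->]|/andP[x0 x1]]; case=> [[-> ->]|/andP[y0 y1]] E //;
  try by exfalso; rewrite ?mulr0n in E; lra.
suff ab : a = b by split=> //; move: E; rewrite ab => /addIr.
apply/eqP; rewrite eqn_leq -[(a <= b)%N]ltnS -[(b <= a)%N]ltnS -!(ltr_nat R) -!natr1.
by apply/andP; split; lra.
Qed.

(** * Box points and the decomposition of lattice points *)

Section Counting.
Variables (R : realType) (n : nat) (K : set (set 'rV[R]_n)).
Variables (N : nat) (A : 'M[R]_(N, n)).
Hypothesis complexK : polytopal_complex K.
Hypothesis integralK : integral_complex K.
Hypothesis rowsA : forall x, lattice x -> complex_support K x ->
  exists i, x = row i A.
Hypothesis latticeA : forall i, lattice (row i A).
Implicit Types (u w : 'rV[R]_N) (t : seq nat).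

Notation reducedK := (reduced (homog A) (cell K A)).

(* The lattice points of the half-open parallelepipeds [0 < u <= 1] spanned by
   the homogenized simplices of the triangulation. *)
Definition box : set 'rV[R]_N :=
  [set u | [/\ reducedK u, u != 0, forall i, u 0 i <= 1, lattice (u *m A) &
               \sum_i u 0 i \is a Num.nat]].

Definition height u : nat := Num.truncn (\sum_i u 0 i).

Lemma heightE u : box u -> \sum_i u 0 i = (height u)%:R.
Proof. by case=> _ _ _ _ /truncnK. Qed.

Lemma box_supp u : box u -> (0 < #|supp u|)%N.
Proof.
case=> _ u0 _ _ _; rewrite lt0n; apply: contra u0 => /eqP/cards0_eq su.
apply/eqP/rowP => i; rewrite mxE; apply: notin_supp.
by rewrite su finset.in_set0.
Qed.

Lemma height_le u : box u -> (height u <= #|supp u|)%N.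
Proof.
move=> bu; rewrite -(@ler_nat R) -heightE //; case: bu => _ _ u1 _ _.
rewrite -sum1_card natr_sum [leRHS]big_mkcond; apply: ler_sum => i _.
by case: ifPn => [_|]; rewrite ?u1 // finset.in_set negbK => /eqP ->.
Qed.

Lemma height_gt0 u : box u -> (0 < height u)%N.
Proof.
move=> bu; have /card_gt0P[i] := box_supp bu; rewrite finset.in_set => ui.
rewrite -(@ltr0n R) -heightE //; case: bu => -[[u0 _] _] _ _ _ _.
apply: (@lt_le_trans _ _ (u 0 i)); first by rewrite lt_def ui u0.
by rewrite (bigD1 i) //= lerDl sumr_ge0.
Qed.

(** Heights are at most [N], and at a fixed height a box point is determined by its image, one of
    the finitely many lattice points of a dilate. *)
Lemma box_finite : finite_set box.
Proof.
have -> : box = \bigcup_(h in `I_N.+1) [set u | box u /\ height u = h].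
  apply/seteqP; split=> [u bu|u [h _ []]//]; exists (height u) => //=.
  rewrite ltnS (leq_trans (height_le bu)) // (leq_trans (max_card _)) //.
  by rewrite card_ord.
apply: bigcup_finite => [|h _]; first exact: finite_II.
pose g (z : 'rV[R]_n) : 'rV[R]_N := xget 0
  [set u | [/\ reducedK u, \sum_i u 0 i = h%:R & z = u *m A]].
apply: (@sub_finite_set _ _
  (g @` (@lattice R n `&` [set h%:R *: x | x in complex_support K]))).
  move=> u [bu hu]; have us := heightE bu; rewrite hu in us.
  have h0 : (0 < h)%N by rewrite -hu height_gt0.
  have ru : reducedK u by case: bu.
  exists (u *m A).
    split; first by case: bu.
    by apply/(lattice_dilate complexK integralK rowsA) => //; exists u.
  have [rg gs gA] : [set u' | [/\ reducedK u', \sum_i u' 0 i = h%:R &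
      u *m A = u' *m A]] (g (u *m A)) by apply: xgetPex; exists u.
  by apply: (reduced_inj ru) => //; apply/homog_eq; rewrite -gA gs us.
by apply: finite_image; apply: finite_lattice_dilate.
Qed.

(** Without the guard, truncated subtraction would yield the zero composition for [k] below the
    height. *)
Definition box_shifts (k : nat) u : seq (seq nat) :=
  if (height u <= k)%N then compositions #|supp u|.-1 (k - height u) else [::].

Lemma mem_box_shifts k u t : box u -> (t \in box_shifts k u) =
  (size t == #|supp u|) && (height u + sumn t == k)%N.
Proof.
move=> bu; rewrite /box_shifts; case: leqP => hk.
  by rewrite mem_compositions prednK ?box_supp //
    -[sumn t == _](eqn_add2l (height u)) subnKC.
by rewrite in_nil; apply/esym/negbTE; rewrite negb_and; lia.
Qed.

Lemma shift_reduced k u t : box u -> t \in box_shifts k u ->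
  [/\ reducedK (u + shift u t), \sum_i (u + shift u t) 0 i = k%:R &
      lattice ((u + shift u t) *m A)].
Proof.
move=> bu; rewrite mem_box_shifts // => /andP[/eqP st /eqP sk].
have us := heightE bu; case: bu => ru _ _ ul _; split.
- apply: (reduced_sub _ ru); first exact: cell_compatible.
    by move=> i; rewrite !mxE addr_ge0 //; case: ru => -[].
  apply/suppP => i iu; rewrite !mxE shift_out //.
  by rewrite notin_supp ?addr0.
- under eq_bigr do rewrite mxE.
  by rewrite big_split /= us sum_shift // -natrD sk.
- rewrite mulmxDl; apply: latticeD => //; apply: lattice_mulmx => // i.
  by rewrite mxE; apply: natr_int.
Qed.

Lemma shift_inj u u' t t' : box u -> box u' ->
  size t = #|supp u| -> size t' = #|supp u'| ->
  u + shift u t = u' + shift u' t' -> u = u' /\ t = t'.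
Proof.
move=> bu bu' st st' /rowP E.
have E' i : u 0 i = u' 0 i /\ shift_at u t i = shift_at u' t' i.
  have := E i; rewrite !mxE.
  have bnd v s : box v -> size s = #|supp v| ->
      (v 0 i = 0 /\ shift_at v s i = 0%N) \/ 0 < v 0 i <= 1.
    case=> -[[v0 _] _] _ v1 _ _ sv; have [vi|vi] := eqVneq (v 0 i) 0.
      by left; split=> //; rewrite shift_out // finset.in_set vi eqxx.
    by right; rewrite lt_def vi v0 v1.
  exact: unit_part_inj (bnd _ _ bu st) (bnd _ _ bu' st').
have uu : u = u' by apply/rowP => i; case: (E' i).
split=> //; rewrite -(map_shift_at st) -(map_shift_at st') uu.
by apply: eq_map => i; case: (E' i); rewrite uu.
Qed.

Lemma reduced_box k w : (0 < k)%N -> reducedK w -> \sum_i w 0 i = k%:R ->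
  lattice (w *m A) ->
  exists u t, [/\ box u, t \in box_shifts k u & w = u + shift u t].
Proof.
move=> k0 rw wk wl; have w0 : forall i, 0 <= w 0 i by case: rw => -[].
(* Ceiling minus one, instead of the floor, leaves a remainder in (0, 1] and so preserves the
   support; zero entries stay 0. *)
pose m (i : 'I_N) := if w 0 i == 0 then 0%N else (absz (Num.ceil (w 0 i))).-1.
have mE i : w 0 i != 0 -> (m i)%:R < w 0 i <= (m i)%:R + 1.
  move=> wi; have wp : 0 < w 0 i by rewrite lt_def wi w0.
  have cp : (0 < Num.ceil (w 0 i))%R by rewrite ceil_gt0.
  have cE : (Num.ceil (w 0 i))%:~R = (m i)%:R + 1 :> R.
    have -> : Num.ceil (w 0 i) = (m i).+1%:Z.
      by rewrite /m (negPf wi) prednK ?gtz0_abs // absz_gt0 gt_eqF.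
    by rewrite natr1.
  by have := ceil_itv (w 0 i); rewrite rmorphB /= cE addrK.
pose u : 'rV[R]_N := w - \row_i (m i)%:R.
have uE i : u 0 i = w 0 i - (m i)%:R by rewrite !mxE.
have su : supp u = supp w.
  apply/setP => i; rewrite !finset.in_set uE; have [wi|/mE] := eqVneq (w 0 i) 0.
    by rewrite /m wi eqxx subrr eqxx.
  by move=> /andP[wi _]; rewrite gt_eqF // subr_gt0.
pose t := [seq m i | i <- enum (supp u)].
have st : size t = #|supp u| by rewrite size_map -cardE.
have sh : shift u t = \row_i (m i)%:R.
  apply/rowP => i; rewrite !mxE; have [iu|iu] := boolP (i \in supp u).
    by rewrite shift_map.
  rewrite shift_out // /m; move: iu; rewrite su finset.in_set negbK => /eqP ->.
  by rewrite eqxx.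
have wE : w = u + shift u t by rewrite sh subrK.
have us : \sum_i u 0 i + (sumn t)%:R = k%:R.
  rewrite -(sum_shift st) -big_split /= -wk; apply: eq_bigr => i _.
  by rewrite [in RHS]wE [RHS]mxE.
have u0 i : 0 <= u 0 i.
  rewrite uE; have [wi|/mE/andP[wi _]] := eqVneq (w 0 i) 0.
    by rewrite /m wi eqxx subrr.
  by rewrite subr_ge0 ltW.
have ru : reducedK u.
  by apply: (reduced_sub _ rw); [exact: cell_compatible| |rewrite su fintype.subxx].
have bu : box u.
  split=> //.
  - apply/eqP => uz; have : w = 0.
      by apply/rowP => i; rewrite notin_supp ?mxE // -su uz finset.in_set mxE eqxx.
    move=> wz; move: wk; rewrite wz big1 => [/esym/eqP|i _]; last by rewrite mxE.
    by rewrite pnatr_eq0 gtn_eqF.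
  - move=> i; rewrite uE; have [wi|/mE/andP[_ wi]] := eqVneq (w 0 i) 0.
      by rewrite /m wi eqxx subrr.
    by rewrite lerBlDl.
  - rewrite mulmxBl; apply: latticeB => //; apply: lattice_mulmx => // i.
    by rewrite mxE; apply: natr_int.
  - rewrite natrEint sumr_ge0 // andbT.
    have -> : \sum_i u 0 i = k%:R - (sumn t)%:R by rewrite -us addrK.
    by rewrite rpredB ?natr_int.
exists u, t; split=> //; rewrite mem_box_shifts // st eqxx /=.
by rewrite -(eqr_nat R) natrD -heightE // us.
Qed.

(** Each lattice point of the dilate has one reduced weight vector of total [k], which splits
    uniquely into a box point and a shift. *)
Lemma ehrhart_box k : (0 < k)%N ->
  ehrhart K k = (\sum_(u <- fset_set box) size (box_shifts k u))%N.
Proof.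
move=> k0; rewrite /ehrhart; pose f u t := (u + shift u t) *m A.
have inbox u : (u \in fset_set box) <-> box u.
  by rewrite (in_fset_set box_finite); split; [move/set_mem|move/mem_set].
pose l := [seq f u t | u <- fset_set box, t <- box_shifts k u].
have Xfin := finite_lattice_dilate k complexK.
suff /perm_size -> : perm_eq
    (fset_set (@lattice R n `&` [set k%:R *: x | x in complex_support K])) l.
  by rewrite size_allpairs_dep sumnE big_map.
apply: uniq_perm; first exact: fset_uniq.
  apply: allpairs_uniq_dep.
  - exact: fset_uniq.
  - move=> u _; rewrite /box_shifts; case: ifP => // _; exact: compositions_uniq.
  move=> x x' /allpairsPdep[u [t [/inbox bu tu ->]]].
  move=> /allpairsPdep[u' [t' [/inbox bu' tu' ->]]] /= E.
  have [r s _] := shift_reduced bu tu; have [r' s' _] := shift_reduced bu' tu'.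
  have [|||uu tt] := shift_inj bu bu' (t := t) (t' := t'); last by rewrite uu tt.
  - by move: tu; rewrite mem_box_shifts // => /andP[/eqP].
  - by move: tu'; rewrite mem_box_shifts // => /andP[/eqP].
  - by apply: (reduced_inj r') => //; apply/homog_eq; rewrite s s'.
move=> z; rewrite in_fset_set //; apply/idP/allpairsPdep.
  move=> /set_mem[zl /(lattice_dilate complexK integralK rowsA _ k0)[w [rw wk zE]]].
  rewrite zE in zl *; have [u [t [bu tu ->]]] := reduced_box k0 rw wk zl.
  by exists u, t; split=> //; apply/inbox.
move=> [u [t [/inbox bu tu ->]]]; apply/mem_set.
have [r s zl] := shift_reduced bu tu; split=> //.
by apply/(lattice_dilate complexK integralK rowsA _ k0); exists (u + shift u t).
Qed.

(** * The f*-contribution of one box point *)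

(** The Vandermonde coefficient of C(k - 1, j) in C(k - h + e, e), for support size e + 1 and height
    h. The guard excludes j > e, where truncated subtraction would give 1. *)
Definition box_fstar u (j : nat) : nat :=
  if (j < #|supp u|)%N then 'C(#|supp u| - height u, #|supp u|.-1 - j) else 0.

(** As the height is at most the support size, Vandermonde applies to natural numbers; for [k] below
    the height the binomial vanishes, matching the empty list. *)
Lemma size_box_shifts d k u : (0 < k)%N -> box u -> (#|supp u| <= d.+1)%N ->
  size (box_shifts k u) = (\sum_(j < d.+1) box_fstar u j * 'C(k.-1, j))%N.
Proof.
move=> k0 bu ud; have u0 := box_supp bu; have hu := height_le bu.
have -> : (\sum_(j < d.+1) box_fstar u j * 'C(k.-1, j) =
    'C(k.-1 + (#|supp u| - height u), #|supp u|.-1))%N.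
  rewrite -binomial.Vandermonde prednK //.
  pose F j := ('C(k.-1, j) * 'C(#|supp u| - height u, #|supp u|.-1 - j))%N.
  rewrite (big_ord_widen d.+1 F ud) [RHS]big_mkcond; apply: eq_bigr => j _.
  by rewrite /box_fstar; case: ifP => // _; rewrite mulnC.
rewrite /box_shifts; case: leqP => hk; last by rewrite bin_small //; lia.
by rewrite size_compositions; congr 'C(_, _); lia.
Qed.


End Counting.

(** * Assembly of the Ehrhart polynomial *)

Lemma poly_of_fstar (R : realType) d (f : 'rV[R]_d.+1) :
  exists2 p : {poly R}, (size p <= d.+1)%N & is_fstar p f.
Proof.
exists (\sum_(j < d.+1) (f 0 j / (j`!)%:R) *: Defs.bpoly R j) => [|x].
  apply: (leq_trans (size_sum _ _ _)); apply/bigmax_leqP => j _.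
  by rewrite (leq_trans (size_scale_leq _ _)) // Defs.size_bpoly.
rewrite horner_sum; apply: eq_bigr => j _; rewrite hornerZ Defs.bpolyE.
by rewrite [gbinom _ _ * _]mulrC mulrA divfK // pnatr_eq0 -lt0n fact_gt0.
Qed.

Lemma lattice_rows (R : realType) n (K : set (set 'rV[R]_n)) :
  polytopal_complex K -> exists N, exists2 A : 'M[R]_(N, n),
    forall x, lattice x -> complex_support K x -> exists i, x = row i A &
    forall i, lattice (row i A).
Proof.
move=> cK; have := finite_lattice_dilate 1 cK.
set X := (_ `&` _) => Xfin; pose s : seq 'rV[R]_n := fset_set X.
have inX x : x \in s <-> X x.
  by rewrite /s in_fset_set //; split; [move/set_mem|move/mem_set].
exists (size s), (\matrix_(i < size s) s`_i) => [x lx Kx|i].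
  have xs : x \in s by apply/inX; split=> //; exists x => //; rewrite scale1r.
  have ix : (index x s < size s)%N by rewrite index_mem.
  by exists (Ordinal ix); rewrite rowK /= nth_index.
by rewrite rowK; have /inX[] := mem_nth 0 (ltn_ord i).
Qed.

Theorem theorem1p3 (R : realType) (n d : nat) (K : set (set 'rV[R]_n)) :
  polytopal_complex K -> integral_complex K -> complex_dim K d ->
  exists2 p : {poly R}, ehrhart_poly K d p &
    forall i : 'I_d.+1, fstar p d 0 i \is a Num.nat.
Proof.
move=> cK iK dK; have [N [A rowsA lA]] := lattice_rows cK.
pose F j := (\sum_(u <- fset_set (box K A)) box_fstar u j)%N.
(* The polynomial is built from the expected coefficients; uniqueness of the f*-vector then
   identifies its entries with the natural numbers [F i]. *)
have [p sp pF] := poly_of_fstar (\row_(j < d.+1) (F j)%:R : 'rV[R]_d.+1).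
exists p => [|i]; last by rewrite (fstar_inj (fstarP sp) pF) mxE natr_nat.
split=> // k k0; rewrite pF (ehrhart_box cK iK rowsA lA k0).
have -> : (\sum_(u <- fset_set (box K A)) size (box_shifts k u) =
    \sum_(j < d.+1) F j * 'C(k.-1, j))%N.
  under [RHS]eq_bigr do rewrite big_distrl /=.
  rewrite exchange_big /=; apply: eq_big_seq => u.
  rewrite (in_fset_set (box_finite cK iK rowsA)) => /set_mem bu.
  apply: (size_box_shifts k0 bu); apply: (card_supp_reduced cK dK).
  by have [ru _ _ _ _] := bu; apply: ru.
rewrite natr_sum; apply: eq_bigr => j _; rewrite mxE natrM.
by rewrite -[in LHS](prednK k0) -natr1 addrK Defs.gbinom_nat.
Qed.
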